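(* Let $\sigma(x)=2\Phi(x)-1$ be the probit activation. Then for all $\mu_1,\mu_2\in\mathbb R$ and all positive semidefinite $\begin{pmatrix}\nu_{11}&\nu_{12}\\ \nu_{12}&\nu_{22}\end{pmatrix}$, $$K_\sigma(\mu_1,\mu_2;\nu_{11},\nu_{22},\nu_{12})=4\left[\Phi_2\!\left(\frac{\mu_1}{\sqrt{1+\nu_{11}}},\frac{\mu_2}{\sqrt{1+\nu_{22}}};\frac{\nu_{12}}{\sqrt{(1+\nu_{11})(1+\nu_{22})}}\right)-\Phi_2\!\left(\frac{\mu_1}{\sqrt{1+\nu_{11}}},\frac{\mu_2}{\sqrt{1+\nu_{22}}};0\right)\right].$$
   Context: $\Phi$ is the standard normal CDF. $\Phi_2(h,k;\rho)=\mathbb P[Z_1\le h,Z_2\le k]$ is the bivariate normal CDF, where $(Z_1,Z_2)$ is jointly normal with zero means, unit variances and correlation $\rho$. $K_\sigma(\mu_1,\mu_2;\nu_{11},\nu_{22},\nu_{12}):=\operatorname{Cov}(\sigma(X_1),\sigma(X_2))$ where $(X_1,X_2)$ is jointly normal with means $\mu_1,\mu_2$ and covariance matrix $\begin{pmatrix}\nu_{11}&\nu_{12}\\ \nu_{12}&\nu_{22}\end{pmatrix}$. *)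

(* Defs.v *)
From HB Require Import structures.
From mathcomp Require Import all_boot all_order all_algebra.
From mathcomp Require Import all_classical all_reals all_analysis.
From mathcomp Require Import measurable_realfun ring lra.
Set Implicit Arguments.
Unset Strict Implicit.
Unset Printing Implicit Defensive.
Import Order.TTheory GRing.Theory Num.Theory.
Import numFieldNormedType.Exports.
Local Open Scope classical_set_scope.
Local Open Scope ring_scope.

Definition psd (R : realType) (n : nat) (S : 'M[R]_n) : Prop :=
  S^T = S /\ forall x : 'rV[R]_n, 0 <= (x *m S *m x^T) ord0 ord0.

Definition mx2 (R : realType) (a b c d : R) : 'M[R]_2 :=
  \matrix_(i < 2, j < 2)
    if i == 0 :> nat then (if j == 0 :> nat then a else b)
    else (if j == 0 :> nat then c else d).

Definition Phi (R : realType) (x : R) : R :=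
  fine (normal_prob (0 : R) 1 `]-oo, x]).

Definition probit (R : realType) (x : R) : R := 2 * Phi x - 1.

(* The law of a pair of independent standard normal variables. *)
Definition stdnormal2 (R : realType) :
    probability (measurableTypeR R * measurableTypeR R)%type R :=
  (normal_prob (0 : R) 1 \x normal_prob (0 : R) 1)%E.

Definition affine2 (R : realType) (mu1 mu2 : R) (A : 'M[R]_2) (z : R * R) :
    R * R :=
  (mu1 + A ord0 ord0 * z.1 + A ord0 ord_max * z.2,
   mu2 + A ord_max ord0 * z.1 + A ord_max ord_max * z.2).

(* (X1, X2) ~ N((mu1, mu2), S): the joint law of (X1, X2) is that of
   mu + A Z for some A with A A^T = S, where Z is a pair of independent
   standard normal variables. S may be singular, in which case there is no
   density. *)
Definition jointly_normal (R : realType) (d : measure_display)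
    (T : measurableType d) (P : probability T R) (X1 X2 : {RV P >-> R})
    (mu1 mu2 : R) (S : 'M[R]_2) : Prop :=
  exists2 A : 'M[R]_2, A *m A^T = S &
    forall B : set (R * R), measurable B ->
      P [set w | B (X1 w, X2 w)] =
      stdnormal2 R [set z | B (affine2 mu1 mu2 A z)].

(* For |rho| <= 1 and (z1, z2) independent standard normal, the pair
   (z1, rho z1 + sqrt (1 - rho^2) z2) is jointly normal with zero means, unit
   variances and correlation rho; see corr_pair_normal. *)
Definition corr_pair1 (R : realType)
    (z : measurableTypeR R * measurableTypeR R) : R := z.1.
Definition corr_pair2 (R : realType) (rho : R)
    (z : measurableTypeR R * measurableTypeR R) : R :=
  rho * z.1 + Num.sqrt (1 - rho ^+ 2) * z.2.

Definition Phi2 (R : realType) (h k rho : R) : R :=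
  fine (stdnormal2 R [set z | corr_pair1 z <= h /\ corr_pair2 rho z <= k]).

Lemma measurable_affine_form (R : realType) (m a b : R) :
  measurable_fun [set: measurableTypeR R * measurableTypeR R]
    (fun z => m + a * z.1 + b * z.2 : R).
Proof.
apply: measurable_funD; last first.
  by apply: measurable_funM => //; exact: measurable_snd.
apply: measurable_funD => //.
by apply: measurable_funM => //; exact: measurable_fst.
Qed.

Lemma mx2_gram (R : realType) (a b c d : R) :
  mx2 a b c d *m (mx2 a b c d)^T =
  mx2 (a ^+ 2 + b ^+ 2) (a * c + b * d) (a * c + b * d) (c ^+ 2 + d ^+ 2).
Proof.
apply/matrixP => i j; rewrite !mxE big_ord_recr /= big_ord1 !mxE /=.
by case: i => [[|[|//]] ?]; case: j => [[|[|//]] ?] /=; ring.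
Qed.

Lemma psd_mx2 (R : realType) (a b c : R) : psd (mx2 a c c b) ->
  forall x y : R, 0 <= a * x ^+ 2 + 2 * c * x * y + b * y ^+ 2.
Proof.
move=> [_ H] x y.
have := H (\row_(j < 2) if j == 0 :> nat then x else y).
rewrite !mxE !big_ord_recr /= !big_ord0 !mxE !big_ord_recr /= !big_ord0 !mxE /=.
by move/le_trans; apply; rewrite le_eqVlt; apply/orP; left; apply/eqP; ring.
Qed.

Lemma psd_chol (R : realType) (a b c : R) : psd (mx2 a c c b) ->
  exists A : 'M[R]_2, A *m A^T = mx2 a c c b.
Proof.
move=> /psd_mx2 H.
have a0 : 0 <= a by have := H 1 0; lra.
have b0 : 0 <= b by have := H 0 1; lra.
have [az|an0] := eqVneq a 0.
  have c0 : c = 0.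
    apply/eqP; apply: contraT => cn0.
    have := H (- (b + 1) / (2 * c)) 1.
    rewrite az mul0r add0r mulr1 expr1n mulr1 mulrC.
    by rewrite -mulrA mulVf ?mulf_neq0// mulr1; lra.
  exists (mx2 0 0 0 (Num.sqrt b)); rewrite mx2_gram sqr_sqrtr// az c0.
  by congr mx2; ring.
have ap : 0 < a by rewrite lt_def an0.
have sn0 : Num.sqrt a != 0 by rewrite sqrtr_eq0 -ltNge.
exists (mx2 (Num.sqrt a) 0 (c / Num.sqrt a) (Num.sqrt (b - c ^+ 2 / a))).
rewrite mx2_gram sqr_sqrtr//.
have -> : Num.sqrt a * (c / Num.sqrt a) + 0 * Num.sqrt (b - c ^+ 2 / a) = c.
  by field.
rewrite expr_div_n !sqr_sqrtr//; first by congr mx2; ring.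
have := H (- c / a) 1.
have -> : a * (- c / a) ^+ 2 + 2 * c * (- c / a) * 1 + b * 1 ^+ 2
   = b - c ^+ 2 / a by field.
by [].
Qed.

Lemma jointly_normal_exists (R : realType) (mu1 mu2 nu11 nu22 nu12 : R) :
  psd (mx2 nu11 nu12 nu12 nu22) ->
  exists X1 X2 : {RV (stdnormal2 R) >-> R},
    jointly_normal X1 X2 mu1 mu2 (mx2 nu11 nu12 nu12 nu22).
Proof.
move=> /psd_chol[A AS].
pose f1 (z : measurableTypeR R * measurableTypeR R) : R :=
  (affine2 mu1 mu2 A z).1.
pose f2 (z : measurableTypeR R * measurableTypeR R) : R :=
  (affine2 mu1 mu2 A z).2.
have m1 : measurable_fun setT f1 by exact: measurable_affine_form.
have m2 : measurable_fun setT f2 by exact: measurable_affine_form.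
pose M1 := isMeasurableFun.Build _ _ _ _ f1 m1.
pose M2 := isMeasurableFun.Build _ _ _ _ f2 m2.
pose X1 : {mfun _ >-> _} := HB.pack f1 M1.
pose X2 : {mfun _ >-> _} := HB.pack f2 M2.
by exists X1, X2, A.
Qed.

Lemma corr_pair_normal (R : realType) (rho : R) : -1 <= rho <= 1 ->
  exists Z1 Z2 : {RV (stdnormal2 R) >-> R},
    [/\ Z1 = @corr_pair1 R :> (_ -> _), Z2 = corr_pair2 rho :> (_ -> _) &
        jointly_normal Z1 Z2 0 0 (mx2 1 rho rho 1)].
Proof.
move=> /andP[r1 r2].
have m1 : measurable_fun [set: measurableTypeR R * measurableTypeR R]
  (@corr_pair1 R : _ -> R) by exact: measurable_fst.
have m2 : measurable_fun [set: measurableTypeR R * measurableTypeR R]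
  (corr_pair2 rho : _ -> R).
  rewrite (_ : corr_pair2 rho = fun z => 0 + rho * z.1 +
    Num.sqrt (1 - rho ^+ 2) * z.2); first exact: measurable_affine_form.
  by apply/funext => z; rewrite /corr_pair2 add0r.
pose M1 := isMeasurableFun.Build _ _ _ _ (@corr_pair1 R) m1.
pose M2 := isMeasurableFun.Build _ _ _ _ (corr_pair2 rho) m2.
pose Z1 : {mfun _ >-> _} := HB.pack (@corr_pair1 R) M1.
pose Z2 : {mfun _ >-> _} := HB.pack (corr_pair2 rho) M2.
exists Z1, Z2; split => //; exists (mx2 1 0 rho (Num.sqrt (1 - rho ^+ 2))).
  rewrite mx2_gram sqr_sqrtr; last by nra.
  by congr mx2; ring.
move=> B mB; congr (stdnormal2 R _); apply/seteqP; split => z /=;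
  by rewrite /affine2 !mxE /= !add0r mul1r mul0r addr0.
Qed.

(* Main.v *)
Require Import Defs.
From HB Require Import structures.
From mathcomp Require Import all_boot all_order all_algebra.
From mathcomp Require Import all_classical all_reals all_analysis.
From mathcomp Require Import measurable_realfun ring.
Import Order.TTheory GRing.Theory Num.Theory.
Import numFieldNormedType.Exports.
Local Open Scope classical_set_scope.
Local Open Scope ring_scope.

(* With [Y i = Phi (X i)], the covariance is
   [4 (E (Y 1 * Y 2) - E (Y 1) E (Y 2))], and
   [E (Y 1 * Y 2)] is the probability that independent standard normal [U i]
   satisfy [U i <= X i].
   Everything is derived from the rotation invariance of the standard normal
   law in the plane, itself a consequence of Fubini and of one-dimensional
   affine changes of variables. A rotation of [(Z1, Z2)] makes the matrix [A]
   with [X = mu + A Z] lower triangular; averaging over [Z2] then only rescales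
   the argument of [Phi]; and a rotation of [(U 1, Z1)] turns [U 1 <= X 1] into
   a half-line condition on a single coordinate [w], so that averaging over the
   other one leaves the integral over [w] that defines [Phi2]. *)

(** * Integrals against the normal law, affine substitution, exchange of integrals *)

Lemma ge0_integral_normal_prob (R : realType) (m s : R) (f : R -> \bar R) :
  measurable_fun setT f -> (forall x, 0 <= f x)%E ->
  (\int[normal_prob m s]_x f x =
   \int[lebesgue_measure]_x (f x * (normal_pdf m s x)%:E))%E.
Proof.
move=> mf f0.
have dom := normal_prob_dominates m s.
rewrite -(Radon_Nikodym_SigmaFinite.change_of_variables dom)//.
have mpdf : measurable_fun setT (EFin \o normal_pdf m s).
  by apply/measurable_EFinP; exact: measurable_normal_pdf.
have iRN := Radon_Nikodym_SigmaFinite.f_integrable dom.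
(* The Radon-Nikodym derivative of [normal_prob m s] and [normal_pdf m s] have the same integral
   over every measurable set, hence agree almost everywhere. *)
apply: ae_eq_integral => //.
- by apply: emeasurable_funM => //; exact: (measurable_int _ iRN).
- by apply: emeasurable_funM.
- apply: ae_eqe_mul2l; apply: integral_ae_eq => //.
  by move=> E _ mE; rewrite -Radon_Nikodym_SigmaFinite.f_integral.
Qed.

Lemma measurable_affine (R : realType) (a b : R) :
  measurable_fun setT (fun x : R => a * x + b).
Proof. by apply: measurable_funD => //; exact: measurable_funM. Qed.

(** The image of Lebesgue measure under [x -> a * x + b], scaled by [|a|], gives every half-open
    interval its length, so by uniqueness it is Lebesgue measure itself. *)
Lemma ge0_integral_lebesgue_affine (R : realType) (a b : R) (f : R -> \bar R) :
  a != 0 -> measurable_fun setT f -> (forall x, 0 <= f x)%E ->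
  (`|a|%:E * \int[lebesgue_measure]_x f (a * x + b)%R =
   \int[lebesgue_measure]_x f x)%E.
Proof.
move=> a0 mf f0.
pose phi : measurableTypeR R -> measurableTypeR R := fun x : R => a * x + b.
have mphi : measurable_fun setT phi by exact: measurable_affine.
pose push :=
  measure_function_pushforward__canonical__measure_function_Measure
    (@lebesgue_measure R) mphi.
pose nu := mscale (NngNum (normr_ge0 a)) push.
have nuE A : measurable A -> lebesgue_measure A = nu A.
  apply: lebesgue_measure_unique => _ [[x y] _ <-] /=.
  rewrite /nu /mscale /push /= /pushforward.
  case: (ltrgtP 0 a) a0 => // [ap|an] _.
  - have -> : phi @^-1` `]x, y] = `](x - b) / a, (y - b) / a]%classic.
      apply/seteqP; split => t /=; rewrite !in_itv/= /phi;
      by rewrite ltr_pdivrMr// ler_pdivlMr// ltrBlDr lerBrDr (mulrC t).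
    rewrite !lebesgue_measure_itv/= !lte_fin ltr_pM2r ?invr_gt0// ltrD2r.
    case: ifPn => _; last by rewrite mule0.
    by rewrite -!EFinD -EFinM gtr0_norm//; congr EFin; field; rewrite gt_eqF.
  (* A negative slope reverses the interval, so the closed end is now the left one; the length is
     not affected. *)
  - have -> : phi @^-1` `]x, y] = `[(y - b) / a, (x - b) / a[%classic.
      apply/seteqP; split => t /=; rewrite !in_itv/= /phi;
      by rewrite ltr_ndivlMr// ler_ndivrMr// ltrBlDr lerBrDr (mulrC t) andbC.
    rewrite !lebesgue_measure_itv/= !lte_fin ltr_nM2r ?invr_lt0// ltrD2r.
    case: ifPn => _; last by rewrite mule0.
    by rewrite -!EFinD -EFinM ltr0_norm//; congr EFin; field; rewrite lt_eqF.
rewrite [RHS](eq_measure_integral nu); last by move=> A mA _; exact: nuE.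
by rewrite ge0_integral_mscale// ge0_integral_pushforward.
Qed.

Lemma ge0_exchange_integral (R : realType)
    (m1 m2 : {sigma_finite_measure set (measurableTypeR R) -> \bar R})
    (f : R -> R -> \bar R) :
  measurable_fun setT (fun z : R * R => f z.1 z.2) ->
  (forall x y, 0 <= f x y)%E ->
  (\int[m1]_x \int[m2]_y f x y = \int[m2]_y \int[m1]_x f x y)%E.
Proof.
move=> mf f0; have := @fubini_tonelli _ _ (measurableTypeR R)
  (measurableTypeR R) R m1 m2 (fun z => f z.1 z.2).
by apply => // z; exact: f0.
Qed.

Lemma measurable_fun_integral_snd (R : realType)
    (m : {sigma_finite_measure set (measurableTypeR R) -> \bar R})
    (f : R -> R -> \bar R) :
  measurable_fun setT (fun z : R * R => f z.1 z.2) ->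
  (forall x y, 0 <= f x y)%E ->
  measurable_fun setT (fun x : R => \int[m]_y f x y)%E.
Proof.
move=> mf f0; have := @measurable_fun_fubini_tonelli_F _ _ (measurableTypeR R)
  (measurableTypeR R) R m (fun z => f z.1 z.2).
by apply => // z; exact: f0.
Qed.

Lemma measurable_fun_integral_fst (R : realType)
    (m : {sigma_finite_measure set (measurableTypeR R) -> \bar R})
    (f : R -> R -> \bar R) :
  measurable_fun setT (fun z : R * R => f z.1 z.2) ->
  (forall x y, 0 <= f x y)%E ->
  measurable_fun setT (fun y : R => \int[m]_x f x y)%E.
Proof.
move=> mf f0; have := @measurable_fun_fubini_tonelli_G _ _ (measurableTypeR R)
  (measurableTypeR R) R m (fun z => f z.1 z.2).
by apply => // z; exact: f0.
Qed.

(** * Rotation invariance of the standard normal law in the plane *)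

Lemma measurable_linear2 (R : realType) (a b c d : R) :
  measurable_fun [set: R * R]
    (fun z : R * R => (a * z.1 + b * z.2, c * z.1 + d * z.2)).
Proof.
by apply: measurable_fun_pair; apply: measurable_funD => //=;
  apply: measurable_funM.
Qed.

(** For [c != 0] the rotation factors into two one-dimensional substitutions: [c * x + s * y]
    becomes the new [x] for fixed [y], then [(y - s * x) / c] becomes the new [y] for fixed [x]. The
    first produces the factor [1 / |c|], which the second absorbs. For [c = 0] the map exchanges the
    coordinates up to signs, since [|s| = 1]. *)
Lemma ge0_integral_lebesgue_rot (R : realType) (c s : R)
    (H : R -> R -> \bar R) :
  c ^+ 2 + s ^+ 2 = 1 -> measurable_fun setT (fun z : R * R => H z.1 z.2) ->
  (forall x y, 0 <= H x y)%E ->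
  (\int[lebesgue_measure]_x \int[lebesgue_measure]_y
     H (c * x + s * y)%R (- s * x + c * y)%R =
   \int[lebesgue_measure]_x \int[lebesgue_measure]_y H x y)%E.
Proof.
move=> cs1 mH H0.
have mHl a b c' d : measurable_fun setT (fun z : R * R =>
    H (a * z.1 + b * z.2)%R (c' * z.1 + d * z.2)%R).
  exact: (measurableT_comp mH (measurable_linear2 R a b c' d)).
have [c0|c0] := eqVneq c 0.
  have s1 : `|s| = 1.
    move: cs1; rewrite c0 expr0n add0r => /eqP.
    by rewrite sqrf_eq1 => /orP[] /eqP ->; rewrite ?normrN normr1.
  have s0 : s != 0 by rewrite -normr_gt0 s1.
  transitivity (\int[lebesgue_measure]_x \int[lebesgue_measure]_y
    H y (- s * x)%R)%E.
    apply: eq_integral => x _.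
    rewrite -(@ge0_integral_lebesgue_affine _ s 0 (fun y => H y (- s * x)%R))//.
      rewrite s1 mul1e; apply: eq_integral => y _.
      by rewrite c0 mul0r add0r mul0r !addr0.
    have := mHl 0 1 (- s) 0.
    move=> /(measurableT_comp)/(_ (pair1_measurable x)) /=.
    by under eq_fun do rewrite /= mul0r add0r mul1r mul0r addr0.
  rewrite (@ge0_exchange_integral _ _ _ (fun x y => H y (- s * x)%R))//=.
    apply: eq_integral => x _.
    rewrite -(@ge0_integral_lebesgue_affine _ (- s) 0 (fun y => H x y))//.
    - rewrite normrN s1 mul1e; apply: eq_integral => y _.
      by rewrite addr0.
    - by rewrite oppr_eq0.
    - exact: (measurableT_comp mH (pair1_measurable x)).
  have := mHl 0 1 (- s) 0.
  by under eq_fun do rewrite mul0r add0r mul1r mul0r addr0.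
have cN : `|c| != 0 by rewrite normr_eq0.
have mH2 : measurable_fun setT
    (fun z : R * R => H z.1 (c^-1 * z.2 + - s / c * z.1)%R).
  have := mHl 1 0 (- s / c) c^-1.
  by under eq_fun do rewrite mul1r mul0r addr0 [_ + c^-1 * _]addrC.
rewrite (@ge0_exchange_integral _ _ _
  (fun x y => H (c * x + s * y)%R (- s * x + c * y)%R))//=.
transitivity (\int[lebesgue_measure]_y (`|c|^-1%:E *
    \int[lebesgue_measure]_x H x (c^-1 * y + - s / c * x)%R))%E.
  apply: eq_integral => y _.
  rewrite -(@ge0_integral_lebesgue_affine _ c (s * y)
    (fun x => H x (c^-1 * y + - s / c * x)%R))//; last first.
    exact: (measurableT_comp mH2 (pair2_measurable y)).
  rewrite muleA -EFinM mulVf// mul1e; apply: eq_integral => x _.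
  (* The second argument is [(y - s * (c * x + s * y)) / c], and [1 - s ^ 2 = c ^ 2] turns it back
     into [- s * x + c * y]. *)
  congr (H _ _); transitivity ((y * (1 - s ^+ 2)) / c - s * x).
    by rewrite -cs1 addrK; field.
  by field.
rewrite ge0_integralZl//=; last 2 first.
- exact: (@measurable_fun_integral_fst _ lebesgue_measure
    (fun x y => H x (c^-1 * y + - s / c * x)%R)).
- by move=> y _; exact: integral_ge0.
rewrite -(@ge0_exchange_integral _ _ _
  (fun x y => H x (c^-1 * y + - s / c * x)%R))//=.
rewrite -ge0_integralZl//=; last 2 first.
- exact: (@measurable_fun_integral_snd _ lebesgue_measure
    (fun x y => H x (c^-1 * y + - s / c * x)%R)).
- by move=> y _; exact: integral_ge0.
apply: eq_integral => x _.
rewrite -normfV.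
rewrite (@ge0_integral_lebesgue_affine _ c^-1 (- s / c * x) (fun y => H x y))//.
  by rewrite invr_eq0.
exact: (measurableT_comp mH (pair1_measurable x)).
Qed.

Lemma ge0_integral_normal_prob2 (R : realType) (F : R -> R -> \bar R) :
  measurable_fun setT (fun z : R * R => F z.1 z.2) ->
  (forall x y, 0 <= F x y)%E ->
  (\int[normal_prob 0 1]_x \int[normal_prob 0 1]_y F x y =
   \int[lebesgue_measure]_x \int[lebesgue_measure]_y
     (F x y * (normal_pdf 0 1 x * normal_pdf 0 1 y)%:E))%E.
Proof.
move=> mF F0; rewrite ge0_integral_normal_prob; last 2 first.
- exact: (measurable_fun_integral_snd R (normal_prob 0 1)).
- by move=> x; exact: integral_ge0.
apply: eq_integral => x _.
have mFx : measurable_fun setT (F x).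
  exact: (measurableT_comp mF (pair1_measurable x)).
rewrite ge0_integral_normal_prob// -ge0_integralZr//=.
- by apply: eq_integral => y _; rewrite -muleA [in RHS]mulrC EFinM.
- apply: emeasurable_funM => //.
  by apply/measurable_EFinP; exact: measurable_normal_pdf.
- by move=> y _; rewrite mule_ge0// lee_fin normal_pdf_ge0.
- by rewrite lee_fin normal_pdf_ge0.
Qed.

Lemma normal_pdf_rot (R : realType) (c s x y : R) : c ^+ 2 + s ^+ 2 = 1 ->
  normal_pdf 0 1 (c * x + s * y) * normal_pdf 0 1 (- s * x + c * y) =
  normal_pdf 0 1 x * normal_pdf 0 1 y.
Proof.
move=> cs1; rewrite normal_pdfE ?oner_neq0// /normal_fun !subr0.
rewrite mulrACA [RHS]mulrACA -!expRD; congr (_ * expR _).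
rewrite -!mulrDl; congr (_ / _).
transitivity (- ((c ^+ 2 + s ^+ 2) * (x ^+ 2 + y ^+ 2))); first by ring.
by rewrite cs1; ring.
Qed.

(** The joint density depends only on [x ^ 2 + y ^ 2], so [normal_pdf_rot] lets it be absorbed into
    the integrand of the Lebesgue version. *)
Lemma ge0_integral_normal_rot (R : realType) (c s : R) (F : R -> R -> \bar R) :
  c ^+ 2 + s ^+ 2 = 1 ->
  measurable_fun setT (fun z : R * R => F z.1 z.2) ->
  (forall x y, 0 <= F x y)%E ->
  (\int[normal_prob 0 1]_x \int[normal_prob 0 1]_y
     F (c * x + s * y)%R (- s * x + c * y)%R =
   \int[normal_prob 0 1]_x \int[normal_prob 0 1]_y F x y)%E.
Proof.
move=> cs1 mF F0.
pose p (x y : R) := (normal_pdf 0 1 x * normal_pdf 0 1 y)%:E.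
have mp : measurable_fun setT (fun z : R * R => p z.1 z.2).
  apply/measurable_EFinP; apply: measurable_funM.
    exact: (measurableT_comp (measurable_normal_pdf 0 1) measurable_fst).
  exact: (measurableT_comp (measurable_normal_pdf 0 1) measurable_snd).
rewrite (@ge0_integral_normal_prob2 _
  (fun x y => F (c * x + s * y) (- s * x + c * y)))//; last first.
  exact: (measurableT_comp mF (measurable_linear2 R c s (- s) c)).
rewrite (ge0_integral_normal_prob2 R F mF F0).
have mFp : measurable_fun setT (fun z : R * R => F z.1 z.2 * p z.1 z.2)%E.
  exact: emeasurable_funM.
have Fp0 x y : (0 <= F x y * p x y)%E.
  by rewrite mule_ge0// lee_fin mulr_ge0 ?normal_pdf_ge0.
rewrite -(ge0_integral_lebesgue_rot R c s _ cs1 mFp Fp0).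
apply: eq_integral => x _; apply: eq_integral => y _ /=.
by rewrite /p normal_pdf_rot.
Qed.

(** * Gaussian averages of [Phi] along affine maps *)

Lemma Phi_ge0 (R : realType) (x : R) : 0 <= Phi x.
Proof. by rewrite /Phi fine_ge0. Qed.

Lemma Phi_le1 (R : realType) (x : R) : Phi x <= 1.
Proof. by rewrite -lee_fin fineK ?fin_num_measure// probability_le1. Qed.

Lemma measurable_Phi (R : realType) : measurable_fun setT (@Phi R).
Proof.
apply: nondecreasing_measurable => // x y xy.
rewrite fine_le ?fin_num_measure// le_measure ?inE//.
by apply: subset_itvl; rewrite bnd_simp.
Qed.

Lemma EFin_Phi (R : realType) (x : R) :
  ((Phi x)%:E = \int[normal_prob 0 1]_u (\1_`]-oo, x] u)%:E)%E.
Proof. by rewrite integral_indic// /Phi fineK ?fin_num_measure// setIT. Qed.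

Lemma measurable_linear (R : realType) (a b : R) :
  measurable_fun [set: R * R] (fun z : R * R => a * z.1 + b * z.2).
Proof.
exact: (measurableT_comp measurable_fst (measurable_linear2 R a b 0 0)).
Qed.

(** Moving [p * z] to the side of [u] leaves a constant threshold and a linear form in [(u, z)], on
    which a rotation can act; the coefficient [1] is kept to match [measurable_linear]. *)
Lemma EFin_Phi_affine (R : realType) (m p z : R) :
  ((Phi (m + p * z))%:E =
   \int[normal_prob 0 1]_u (\1_`]-oo, m] (1 * u + - p * z)%R)%:E)%E.
Proof.
rewrite EFin_Phi; apply: eq_integral => u _.
by rewrite !indicE !mem_setE !in_itv/= mul1r mulNr lerBlDr.
Qed.

(* Rotates the pair [(u, z)], where [u] is the variable integrated in [Phi], so
   that [u <= m + p * z] becomes a condition on the first coordinate [w]. *)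
Lemma integral_Phi_affine_mul (R : realType) (m p : R) (G : R -> \bar R) :
  measurable_fun setT G -> (forall x, 0 <= G x)%E ->
  (\int[normal_prob 0 1]_z ((Phi (m + p * z))%:E * G z) =
   \int[normal_prob 0 1]_w ((\1_`]-oo, (m / Num.sqrt (1 + p ^+ 2))%R] w)%:E *
     \int[normal_prob 0 1]_t G ((t - p * w) / Num.sqrt (1 + p ^+ 2))%R))%E.
Proof.
move=> mG G0; set r := Num.sqrt _.
have rr : r ^+ 2 = 1 + p ^+ 2 by rewrite sqr_sqrtr// addr_ge0// sqr_ge0.
have r0 : 0 < r by rewrite sqrtr_gt0 ltr_pwDl// sqr_ge0.
have rn : r != 0 by rewrite gt_eqF.
pose K u z := ((\1_`]-oo, m] (1 * u + - p * z)%R)%:E * G z)%E.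
have mI : measurable_fun setT (\1_`]-oo, m] : R -> R).
  exact: measurable_indic.
have mK : measurable_fun setT (fun z : R * R => K z.1 z.2).
  apply: emeasurable_funM; last exact: (measurableT_comp mG measurable_snd).
  apply/measurable_EFinP.
  exact: (measurableT_comp mI (measurable_linear R 1 (- p))).
have K0 x y : (0 <= K x y)%E by rewrite mule_ge0// lee_fin.
transitivity (\int[normal_prob 0 1]_z \int[normal_prob 0 1]_u K u z)%E.
  apply: eq_integral => z _; rewrite EFin_Phi_affine -ge0_integralZr//=.
  apply/measurable_EFinP.
  apply: (measurableT_comp mI).
  exact: (measurableT_comp (measurable_linear R 1 (- p)) (pair2_measurable z)).
rewrite -(ge0_exchange_integral R _ _ K mK K0).
(* The rotation puts [u = (w + p * t) / r] and [z = (t - p * w) / r], so that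
   [u - p * z = w * (1 + p ^ 2) / r = r * w]: the condition becomes [w <= m / r], free of [t]. *)
have cs1 : r^-1 ^+ 2 + (p / r) ^+ 2 = 1.
  transitivity ((1 + p ^+ 2) / r ^+ 2); first by field.
  by rewrite -rr divff// sqrf_eq0.
rewrite -(ge0_integral_normal_rot R _ _ _ cs1 mK K0).
apply: eq_integral => w _; rewrite -ge0_integralZl//=.
  apply: eq_integral => t _; rewrite /K; congr ((_ * _)%E); last first.
    by congr G; field.
  congr EFin; rewrite !indicE !mem_setE !in_itv/= ler_pdivlMr//.
  congr ((_ (_ <= _))%:R).
  transitivity (w * ((1 + p ^+ 2) / r)); first by field.
  by rewrite -rr; field.
apply: (measurableT_comp mG).
have := measurable_affine R r^-1 (- (p * w) / r).
by under eq_fun do rewrite mulrC -mulrDl.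
Qed.

Lemma integral_normal_prob1 (R : realType) (m s : R) :
  (\int[normal_prob m s]_x 1 = 1)%E.
Proof.
by rewrite integral_cst// mul1e; exact: (probability_setT (normal_prob m s)).
Qed.

(** With [G = 1] in [integral_Phi_affine_mul], the inner integral is the total mass and only the
    half-line in [w] remains. *)
Lemma integral_Phi_affine (R : realType) (m p : R) :
  (\int[normal_prob 0 1]_z (Phi (m + p * z))%:E =
   (Phi (m / Num.sqrt (1 + p ^+ 2)))%:E)%E.
Proof.
transitivity (\int[normal_prob 0 1]_z ((Phi (m + p * z))%:E * cst 1 z))%E.
  by apply: eq_integral => z _; rewrite mule1.
rewrite (integral_Phi_affine_mul R m p (cst 1%E))//=.
by under eq_integral do rewrite integral_normal_prob1 mule1; rewrite -EFin_Phi.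
Qed.

Lemma measurable_Phi_affine (R : realType) (m p : R) :
  measurable_fun setT (fun x : R => Phi (m + p * x)).
Proof.
apply: (measurableT_comp (measurable_Phi R)).
by have := @measurable_affine R p m; under eq_fun do rewrite addrC.
Qed.

(** The second [Phi] serves as [G]. After the rotation its argument is still affine in [t], so
    [integral_Phi_affine] evaluates the inner integral, leaving an integral over [w] of the form
    found in [EFin_Phi2]. *)
Lemma integral_Phi_affine2 (R : realType) (m p q k : R) :
  (\int[normal_prob 0 1]_z (Phi (m + p * z) * Phi (q + k * z))%:E =
   \int[normal_prob 0 1]_w
     (\1_`]-oo, (m / Num.sqrt (1 + p ^+ 2))%R] w *
      Phi ((Num.sqrt (1 + p ^+ 2) * q - k * p * w) /
           Num.sqrt (1 + p ^+ 2 + k ^+ 2)))%:E)%E.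
Proof.
under eq_integral do rewrite EFinM.
rewrite (integral_Phi_affine_mul R m p
  (fun z => (Phi (q + k * z))%:E)); last 2 first.
- by apply/measurable_EFinP; exact: measurable_Phi_affine.
- by move=> x; rewrite lee_fin Phi_ge0.
have sp : 0 < 1 + p ^+ 2 by rewrite ltr_pwDl// sqr_ge0.
set s := Num.sqrt (1 + p ^+ 2).
have s2 : s ^+ 2 = 1 + p ^+ 2 by rewrite sqr_sqrtr// ltW.
have s0 : 0 < s by rewrite sqrtr_gt0.
have sn : s != 0 by rewrite gt_eqF.
apply: eq_integral => w _; rewrite EFinM; congr (_ * _)%E.
transitivity (\int[normal_prob 0 1]_t
    (Phi (q - k * p * w / s + (k / s) * t))%:E)%E.
  by apply: eq_integral => t _; congr (Phi _)%:E; field.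
rewrite integral_Phi_affine; congr (Phi _)%:E.
have sk : 0 < 1 + (k / s) ^+ 2 by rewrite ltr_pwDl// sqr_ge0.
have -> : Num.sqrt (1 + p ^+ 2 + k ^+ 2) = s * Num.sqrt (1 + (k / s) ^+ 2).
  rewrite -[X in X * _]ger0_norm ?ltW// -sqrtr_sqr -sqrtrM ?sqr_ge0//.
  by congr Num.sqrt; rewrite -s2; field.
by field; rewrite sn gt_eqF// sqrtr_gt0.
Qed.

(** * [Phi2] as a one-dimensional integral, and averages of products of two [Phi] *)

Lemma EFin_Phi2 (R : realType) (h k rho : R) : rho ^+ 2 < 1 ->
  ((Phi2 h k rho)%:E = \int[normal_prob 0 1]_w
     (\1_`]-oo, h] w * Phi ((k - rho * w) / Num.sqrt (1 - rho ^+ 2)))%:E)%E.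
Proof.
move=> rho1.
have s0 : 0 < Num.sqrt (1 - rho ^+ 2) by rewrite sqrtr_gt0 subr_gt0.
have mA : measurable
    [set z : R * R | corr_pair1 z <= h /\ corr_pair2 rho z <= k].
  apply: measurableI.
    have := @measurable_fst _ _ R R measurableT _ (measurable_itv `]-oo, h]).
    by rewrite setTI set_itvNyc.
  have := measurable_linear R rho (Num.sqrt (1 - rho ^+ 2)) measurableT _
    (measurable_itv `]-oo, k]).
  by rewrite setTI set_itvNyc.
rewrite /Phi2 fineK ?fin_num_measure//.
rewrite /stdnormal2 /= /product_measure1.
apply: eq_integral => w _ /=.
(* The section of the event at [w] is empty for [w > h]; otherwise it is the half-line ending at
   [(k - rho * w) / sqrt (1 - rho ^ 2)]. *)
rewrite indicE mem_setE in_itv/=; case: (leP w h) => wh /=.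
  rewrite mul1r /Phi fineK ?fin_num_measure//; congr normal_prob.
  apply/seteqP; split => y; rewrite /xsection/= inE/= in_itv/= /corr_pair2 /=.
    by move=> [_]; rewrite ler_pdivlMr// (mulrC y) -lerBrDl.
  by rewrite ler_pdivlMr// (mulrC y) -lerBrDl.
rewrite mul0r [X in normal_prob _ _ X](_ : _ = set0) ?measure0//.
apply/seteqP; split => y //; rewrite /xsection/= inE/= => -[].
by rewrite leNgt => /negP.
Qed.

(** Only the second factor involves [y], so averaging over [y] divides its argument by
    [v = sqrt (1 + r ^ 2)]. What remains is an integral over [x] alone, which [integral_Phi_affine2]
    brings to the form of [EFin_Phi2]. *)
Lemma integral_Phi_triangular (R : realType) (m1 m2 p q r : R) :
  (\int[normal_prob 0 1]_x \int[normal_prob 0 1]_y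
     (Phi (m1 + p * x) * Phi (m2 + q * x + r * y))%:E =
   (Phi2 (m1 / Num.sqrt (1 + p ^+ 2)) (m2 / Num.sqrt (1 + (q ^+ 2 + r ^+ 2)))
      (p * q / Num.sqrt ((1 + p ^+ 2) * (1 + (q ^+ 2 + r ^+ 2)))))%:E)%E.
Proof.
have sqrp (x : R) : 0 <= x -> 0 < 1 + x by move=> ?; rewrite ltr_pwDl.
have vp : 0 < 1 + r ^+ 2 by rewrite sqrp// sqr_ge0.
have sp : 0 < 1 + p ^+ 2 by rewrite sqrp// sqr_ge0.
have tp : 0 < 1 + (q ^+ 2 + r ^+ 2) by rewrite sqrp// addr_ge0// sqr_ge0.
rewrite sqrtrM; last exact: ltW.
set v := Num.sqrt (1 + r ^+ 2).
set s := Num.sqrt (1 + p ^+ 2).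
set t := Num.sqrt (1 + (q ^+ 2 + r ^+ 2)).
have v2 : v ^+ 2 = 1 + r ^+ 2 by rewrite sqr_sqrtr// ltW.
have s2 : s ^+ 2 = 1 + p ^+ 2 by rewrite sqr_sqrtr// ltW.
have t2 : t ^+ 2 = 1 + (q ^+ 2 + r ^+ 2) by rewrite sqr_sqrtr// ltW.
have v0 : v != 0 by rewrite gt_eqF// sqrtr_gt0.
have s0 : s != 0 by rewrite gt_eqF// sqrtr_gt0.
have t0 : t != 0 by rewrite gt_eqF// sqrtr_gt0.
have Dp : 0 < 1 + p ^+ 2 + (q / v) ^+ 2 by rewrite ltr_wpDr// sqr_ge0.
(* With [rho = p * q / (s * t)], this rests on [s ^ 2 * t ^ 2 - p ^ 2 * q ^ 2 = v ^ 2 * (1 + p ^ 2)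
   + q ^ 2]. It yields both [rho ^ 2 < 1], even when [p] or [r] vanishes, and the value
   [v / (s * t) * D] of [sqrt (1 - rho ^ 2)]. *)
have vst : (v / (s * t)) ^+ 2 * (1 + p ^+ 2 + (q / v) ^+ 2) =
           1 - (p * q / (s * t)) ^+ 2.
  transitivity ((v ^+ 2 * (1 + p ^+ 2) + q ^+ 2) / (s ^+ 2 * t ^+ 2)).
    by field; rewrite ?v0 ?s0 ?t0.
  transitivity ((s ^+ 2 * t ^+ 2 - p ^+ 2 * q ^+ 2) / (s ^+ 2 * t ^+ 2)).
    by congr (_ / _); rewrite v2 s2 t2; ring.
  by field; rewrite ?s0 ?t0.
have rho1 : (p * q / (s * t)) ^+ 2 < 1.
  rewrite -subr_gt0 -vst mulr_gt0// exprn_even_gt0//=.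
  by rewrite !mulf_neq0// invr_eq0 mulf_neq0.
rewrite EFin_Phi2// -vst sqrtrM ?sqr_ge0// sqrtr_sqr ger0_norm; last first.
  by rewrite divr_ge0 ?mulr_ge0 ?sqrtr_ge0.
set D := Num.sqrt _ in vst *.
have D0 : D != 0 by rewrite gt_eqF// sqrtr_gt0.
transitivity (\int[normal_prob 0 1]_x
   (Phi (m1 + p * x) * Phi (m2 / v + q / v * x))%:E)%E.
  apply: eq_integral => x _; under eq_integral do rewrite EFinM.
  rewrite ge0_integralZl//=.
  - rewrite integral_Phi_affine -EFinM; congr (_ * Phi _)%:E.
    by rewrite -/v; field.
  - by apply/measurable_EFinP; exact: measurable_Phi_affine.
  - by move=> y _; rewrite lee_fin Phi_ge0.
  - by rewrite lee_fin Phi_ge0.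
rewrite integral_Phi_affine2; apply: eq_integral => w _.
congr (_ * Phi _)%:E; rewrite -/s -/D.
by field; rewrite ?s0 ?t0 ?v0 ?D0.
Qed.

Lemma integral_Phi_Phi (R : realType) (m1 m2 a b c d : R) :
  (\int[normal_prob 0 1]_x \int[normal_prob 0 1]_y
     (Phi (m1 + a * x + b * y) * Phi (m2 + c * x + d * y))%:E =
   (Phi2 (m1 / Num.sqrt (1 + (a ^+ 2 + b ^+ 2)))
      (m2 / Num.sqrt (1 + (c ^+ 2 + d ^+ 2)))
      ((a * c + b * d) /
         Num.sqrt ((1 + (a ^+ 2 + b ^+ 2)) * (1 + (c ^+ 2 + d ^+ 2)))))%:E)%E.
Proof.
(* A zero first row has no direction to rotate, but the matrix is then already lower triangular,
   with [p = 0]. *)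
have [/eqP|n0] := eqVneq (a ^+ 2 + b ^+ 2) 0.
  rewrite paddr_eq0 ?sqr_ge0// !sqrf_eq0 => /andP[/eqP -> /eqP ->].
  transitivity (\int[normal_prob 0 1]_x \int[normal_prob 0 1]_y
     (Phi (m1 + 0 * x) * Phi (m2 + c * x + d * y))%:E)%E.
    apply: eq_integral => x _; apply: eq_integral => y _.
    by rewrite [0 * y]mul0r addr0.
  have z2 : (0 : R) ^+ 2 + 0 ^+ 2 = 0 ^+ 2 by rewrite expr0n addr0.
  by rewrite integral_Phi_triangular [0 * d]mul0r addr0 z2.
pose p := Num.sqrt (a ^+ 2 + b ^+ 2).
have p2 : p ^+ 2 = a ^+ 2 + b ^+ 2 by rewrite sqr_sqrtr// addr_ge0// sqr_ge0.
have p0 : p != 0 by rewrite -sqrf_eq0 p2.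
have cs1 : (a / p) ^+ 2 + (b / p) ^+ 2 = 1.
  by rewrite !expr_div_n -mulrDl p2 divff.
(* [(p, 0)] and [(q, r)] are the rows [(a, b)] and [(c, d)] after the rotation
   that sends [(a, b)] to the first axis. *)
pose q := (a * c + b * d) / p.
pose r := (a * d - b * c) / p.
pose F x y := (Phi (m1 + p * x) * Phi (m2 + q * x + r * y))%:E.
have mF : measurable_fun setT (fun z : R * R => F z.1 z.2).
  apply/measurable_EFinP; apply: measurable_funM.
    exact: (measurableT_comp (measurable_Phi_affine R m1 p) measurable_fst).
  apply: (measurableT_comp (measurable_Phi R)).
  exact: measurable_affine_form.
have F0 x y : (0 <= F x y)%E by rewrite lee_fin mulr_ge0 ?Phi_ge0.
(* Lagrange's identity: [(a * c + b * d) ^ 2 + (a * d - b * c) ^ 2 = (a ^ 2 + b ^ 2) * (c ^ 2 + d ^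
   2)]. Together with [p2] and [pq], it says that the rotation preserves the covariance matrix. *)
have qr : q ^+ 2 + r ^+ 2 = c ^+ 2 + d ^+ 2.
  transitivity ((a ^+ 2 + b ^+ 2) * (c ^+ 2 + d ^+ 2) / p ^+ 2).
    by rewrite /q /r; field.
  by rewrite -p2; field.
have pq : p * q = a * c + b * d by rewrite /q; field.
rewrite -p2 -qr -pq -integral_Phi_triangular.
apply: etrans (ge0_integral_normal_rot R _ _ F cs1 mF F0).
apply: eq_integral => x _; apply: eq_integral => y _.
rewrite /F; congr (Phi _ * Phi _)%:E; first by field.
rewrite -!addrA; congr (_ + _).
transitivity ((c * x + d * y) * (a ^+ 2 + b ^+ 2) / p ^+ 2).
  by rewrite -p2; field.
by rewrite /q /r; field.
Qed.

(** Averaging over [y], then over [x], rescales the argument twice, and the scales combine through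
    [v ^ 2 * (1 + (a / v) ^ 2) = 1 + a ^ 2 + b ^ 2]. *)
Lemma integral_Phi_linear (R : realType) (m a b : R) :
  (\int[normal_prob 0 1]_x \int[normal_prob 0 1]_y
     (Phi (m + a * x + b * y))%:E =
   (Phi (m / Num.sqrt (1 + (a ^+ 2 + b ^+ 2))))%:E)%E.
Proof.
have bp : 0 < 1 + b ^+ 2 by rewrite ltr_pwDl// sqr_ge0.
set v := Num.sqrt (1 + b ^+ 2).
have v2 : v ^+ 2 = 1 + b ^+ 2 by rewrite sqr_sqrtr// ltW.
have vp : 0 < v by rewrite sqrtr_gt0.
have v0 : v != 0 by rewrite gt_eqF.
transitivity (\int[normal_prob 0 1]_x (Phi (m / v + a / v * x))%:E)%E.
  apply: eq_integral => x _; rewrite integral_Phi_affine -/v.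
  by congr (Phi _)%:E; field.
rewrite integral_Phi_affine; congr (Phi _)%:E.
have -> : 1 + (a ^+ 2 + b ^+ 2) = v ^+ 2 * (1 + (a / v) ^+ 2).
  by rewrite addrCA addrC -v2; field.
rewrite sqrtrM ?sqr_ge0// sqrtr_sqr gtr0_norm//; field.
by rewrite v0 gt_eqF// sqrtr_gt0 ltr_pwDl// sqr_ge0.
Qed.

(** At [rho = 0] the second factor in [EFin_Phi2] is the constant [Phi k]. This is how the product
    of the two means becomes the subtracted [Phi2] term. *)
Lemma Phi2_0 (R : realType) (h k : R) : Phi2 h k 0 = Phi h * Phi k.
Proof.
apply: EFin_inj; rewrite EFin_Phi2 ?expr0n ?ltr01//=.
under eq_integral do rewrite mul0r !subr0 sqrtr1 divr1 mulrC EFinM.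
rewrite ge0_integralZl//=; last by rewrite lee_fin Phi_ge0.
  by rewrite -EFin_Phi -EFinM mulrC.
by apply/measurable_EFinP; exact: measurable_indic.
Qed.

(** * Reduction of the covariance to integrals over the standard normal plane *)

Lemma Lfun1_unit_interval (R : realType) d (T : measurableType d)
    (P : probability T R) (Y : T -> R) :
  measurable_fun setT Y -> (forall w, 0 <= Y w <= 1) -> Y \in Lfun P 1.
Proof.
move=> mY Y01; apply/Lfun1_integrable/measurable_bounded_integrable => //.
  exact: (le_lt_trans (probability_le1 P measurableT) (ltry 1)).
exists 1; split; first exact: num_real.
move=> x x1 w _ /=; apply: le_trans (ltW x1).
by have /andP[y0 y1] := Y01 w; rewrite ger0_norm.
Qed.

Lemma covariance_2B1 (R : realType) d (T : measurableType d)
    (P : probability T R) (Y1 Y2 : T -> R) (e1 e2 e12 : R) :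
  measurable_fun setT Y1 -> (forall w, 0 <= Y1 w <= 1) ->
  measurable_fun setT Y2 -> (forall w, 0 <= Y2 w <= 1) ->
  (\int[P]_w (Y1 w)%:E = e1%:E)%E -> (\int[P]_w (Y2 w)%:E = e2%:E)%E ->
  (\int[P]_w (Y1 w * Y2 w)%:E = e12%:E)%E ->
  covariance P (fun w => 2 * Y1 w - 1) (fun w => 2 * Y2 w - 1) =
  (4 * (e12 - e1 * e2))%:E.
Proof.
move=> mY1 Y1b mY2 Y2b E1 E2 E12.
have L1 : Y1 \in Lfun P 1 by exact: Lfun1_unit_interval.
have L2 : Y2 \in Lfun P 1 by exact: Lfun1_unit_interval.
have L12 : (Y1 * Y2 : T -> R) \in Lfun P 1.
  apply: Lfun1_unit_interval; first exact: measurable_funM.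
  move=> w; have /andP[a0 a1] := Y1b w; have /andP[b0 b1] := Y2b w.
  by rewrite mulr_ge0// mulr_ile1.
have Lc (c : R) : (cst c : T -> R) \in Lfun P 1 by exact: Lfun_cst.
have LZ (c : R) (Y : T -> R) : Y \in Lfun P 1 -> c \o* Y \in Lfun P 1.
  by move=> LY; apply: Lfun_scale.
have LB (Y Z : T -> R) :
    Y \in Lfun P 1 -> Z \in Lfun P 1 -> Y \- Z \in Lfun P 1.
  by move=> LY LZ'; apply: rpredB.
have X1E : (fun w => 2 * Y1 w - 1) = 2 \o* Y1 \- cst 1.
  by apply/funext => w /=; rewrite mulrC.
have X2E : (fun w => 2 * Y2 w - 1) = 2 \o* Y2 \- cst 1.
  by apply/funext => w /=; rewrite mulrC.
(* The expansion is grouped into differences and scalings only, so that [LB] and [LZ] supply the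
   integrability of every piece to which linearity of expectation is applied. *)
have X12E : ((2 \o* Y1 \- cst 1) * (2 \o* Y2 \- cst 1) : T -> R) =
    4 \o* (Y1 * Y2) \- 2 \o* Y1 \- (2 \o* Y2 \- cst 1).
  by apply/funext => w; rewrite !fctE/=; ring.
rewrite X1E X2E covarianceE ?X12E; [|by auto..].
rewrite !expectationB ?expectationZl; try by auto 10.
rewrite expectation_cst unlock E1 E2 [X in (4 * X)%E](_ : _ = e12%:E)//.
by rewrite -?(EFinM, EFinB); congr EFin; ring.
Qed.

(** Both sides integrate [G] against image measures, which [jointly_normal] makes equal on
    measurable sets; Tonelli then splits the plane. No density of the pair is involved, so singular
    covariance matrices are covered. The entries of [A] are exposed with [A A^T] written out, the
    form in which the averages of [Phi] are stated. *)
Lemma jointly_normal_integral (R : realType) d (T : measurableType d)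
    (P : probability T R) (X1 X2 : {RV P >-> R}) (mu1 mu2 nu11 nu22 nu12 : R) :
  jointly_normal X1 X2 mu1 mu2 (mx2 nu11 nu12 nu12 nu22) ->
  exists a b c e, [/\ a ^+ 2 + b ^+ 2 = nu11, c ^+ 2 + e ^+ 2 = nu22,
    a * c + b * e = nu12 &
    forall G : R -> R -> \bar R,
      measurable_fun setT (fun z : R * R => G z.1 z.2) ->
      (forall x y, 0 <= G x y)%E ->
      (\int[P]_w G (X1 w) (X2 w) =
       \int[normal_prob 0 1]_x \int[normal_prob 0 1]_y
          G (mu1 + a * x + b * y)%R (mu2 + c * x + e * y)%R)%E].
Proof.
move=> [A AA hP].
have AE i j : (A *m A^T) i j = A i ord0 * A j ord0 + A i ord_max * A j ord_max.
  by rewrite !mxE big_ord_recr /= big_ord1 !mxE;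
  congr (A _ _ * A _ _ + _); exact: val_inj.
exists (A ord0 ord0), (A ord0 ord_max), (A ord_max ord0), (A ord_max ord_max).
split.
- by have := AE ord0 ord0; rewrite AA !mxE/= => ->.
- by have := AE ord_max ord_max; rewrite AA !mxE/= => ->.
- by have := AE ord0 ord_max; rewrite AA !mxE/= => ->.
move=> G mG G0.
have mX : measurable_fun setT (fun w => (X1 w, X2 w) : R * R).
  exact: measurable_fun_pair.
have mA : measurable_fun [set: measurableTypeR R * measurableTypeR R]
    (affine2 mu1 mu2 A).
  by apply: measurable_fun_pair; exact: measurable_affine_form.
have GX := ge0_integral_pushforward mX P measurableT mG (fun z _ => G0 z.1 z.2).
have GA := ge0_integral_pushforward mA (stdnormal2 R) measurableT mG
  (fun z _ => G0 z.1 z.2).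
rewrite !preimage_setT in GX GA.
transitivity (\int[stdnormal2 R]_z
  G (affine2 mu1 mu2 A z).1 (affine2 mu1 mu2 A z).2)%E.
  apply: etrans (esym GX) _; apply: etrans _ GA.
  by apply: eq_measure_integral => B mB _; exact: hP.
have := @fubini_tonelli1 _ _ (measurableTypeR R) (measurableTypeR R) R
  (normal_prob 0 1) (normal_prob 0 1)
  (fun z => G (affine2 mu1 mu2 A z).1 (affine2 mu1 mu2 A z).2).
apply; last by move=> z; exact: G0.
exact: (measurableT_comp mG mA).
Qed.

Theorem lemmaC2 (R : realType) (mu1 mu2 nu11 nu22 nu12 : R)
  (hpsd : psd (mx2 nu11 nu12 nu12 nu22))
  (d : measure_display) (T : measurableType d) (P : probability T R)
  (X1 X2 : {RV P >-> R})
  (hX : jointly_normal X1 X2 mu1 mu2 (mx2 nu11 nu12 nu12 nu22)) :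
  covariance P (@probit R \o X1) (@probit R \o X2) =
  (4 * (Phi2 (mu1 / Num.sqrt (1 + nu11)) (mu2 / Num.sqrt (1 + nu22))
             (nu12 / Num.sqrt ((1 + nu11) * (1 + nu22)))
        - Phi2 (mu1 / Num.sqrt (1 + nu11)) (mu2 / Num.sqrt (1 + nu22)) 0))%:E.
Proof.
have /jointly_normal_integral[a [b [c [e [<- <- <- EG]]]]] := hX.
have mPhi := measurable_Phi R.
have mPhi1 : measurable_fun setT (fun z : R * R => Phi z.1).
  exact: (measurableT_comp mPhi measurable_fst).
have mPhi2 : measurable_fun setT (fun z : R * R => Phi z.2).
  exact: (measurableT_comp mPhi measurable_snd).
have mY (X : {RV P >-> R}) : measurable_fun setT (@Phi R \o X).
  exact: measurableT_comp.
have Y01 (X : {RV P >-> R}) w : 0 <= Phi (X w) <= 1.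
  by rewrite Phi_ge0 Phi_le1.
(* Once the subtracted term is a product, the right-hand side has the form [4 * (e12 - e1 * e2)],
   and the three goals left are the two means and the mean of the product. *)
rewrite Phi2_0; apply: (covariance_2B1 R d T P (@Phi R \o X1)
  (@Phi R \o X2)) => //=.
- rewrite -integral_Phi_linear (EG (fun x _ => (Phi x)%:E))//.
    exact/measurable_EFinP.
  by move=> *; rewrite lee_fin Phi_ge0.
- rewrite -integral_Phi_linear (EG (fun _ y => (Phi y)%:E))//.
    exact/measurable_EFinP.
  by move=> *; rewrite lee_fin Phi_ge0.
- rewrite -integral_Phi_Phi (EG (fun x y => (Phi x * Phi y)%:E))//.
    by apply/measurable_EFinP; exact: measurable_funM.
  by move=> *; rewrite lee_fin mulr_ge0 ?Phi_ge0.
Qed.
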